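(* A unit of $\mathcal{O}$ other than $1$ or $-1$ is not a sum of two cubes in $\mathcal{K}$; that is, it is not of the form $x^3+y^3$ with $x,y\in\mathcal{K}$.
   Context: Let $u$ and $v$ be the two roots in $\mathbb{C}$ of $z^{2}+z+1=0$ (so $u,v$ are the primitive cube roots of unity). $\mathcal{O}$ is the set of $\mathbb{Z}$-linear combinations of $1,u,v$ (the ring of Eisenstein integers) and $\mathcal{K}$ is the set of $\mathbb{Q}$-linear combinations of $1,u,v$ (its field of fractions). The units of $\mathcal{O}$ are $\pm1,\pm u,\pm v$. *)

(* Defs.v *)
From mathcomp Require Import all_boot all_order all_algebra.
From mathcomp Require Import reals complex.

Set Implicit Arguments.
Unset Strict Implicit.
Unset Printing Implicit Defensive.

Import Order.TTheory GRing.Theory Num.Theory.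

Local Open Scope ring_scope.

Definition in_O (C : fieldType) (u v z : C) : Prop :=
  exists a b c : int, z = a%:~R + b%:~R * u + c%:~R * v.

Definition in_K (C : fieldType) (u v z : C) : Prop :=
  exists a b c : rat, z = ratr a + ratr b * u + ratr c * v.

Definition unit_O (C : fieldType) (u v z : C) : Prop :=
  in_O u v z /\ exists2 w : C, in_O u v w & z * w = 1.

(* Main.v *)
(* Write w for a primitive cube root of unity and l = 1 - w, a prime dividing 3.
   Clearing denominators and common factors, a counterexample yields coprime
   Eisenstein integers x, y and z <> 0 with x^3 + y^3 = e z^3. Cubes are rational
   integers modulo 3, so, e being a unit other than 1 and -1, l divides z. Fermat's
   descent excludes this for every unit e: since cubes prime to l are 1 or -1
   modulo 9, l^2 divides z; then x + y, x + w y and x + w^2 y are l p, l q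
   and l r, where p, q, r are pairwise coprime with product e (z / l)^3, hence
   each is a unit times a cube. As p + w q + w^2 r = 0 and l
   divides exactly one of p, q, r, reduction modulo 3 turns this relation into a
   solution of the same shape whose z has smaller norm. *)

Require Import Defs.
From HB Require Import structures.
From mathcomp Require Import all_boot all_order all_algebra.
From mathcomp Require Import reals complex.
From mathcomp Require Import ring zify.

Set Implicit Arguments.
Unset Strict Implicit.
Unset Printing Implicit Defensive.

Import Order.TTheory GRing.Theory Num.Theory.

Local Open Scope ring_scope.

(** * The ring of Eisenstein integers and its norm *)

(* The pair (a, b) stands for a + b w, where w ^+ 2 + w + 1 = 0. *)
Definition eis : Type := (int * int)%type.

HB.instance Definition _ := GRing.Zmodule.on eis.

Implicit Types x y z e d : eis.

Lemma eisP x y : x.1 = y.1 -> x.2 = y.2 -> x = y.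
Proof. by case: x y => [a b] [c d] /= -> ->. Qed.

Definition emul x y : eis :=
  (x.1 * y.1 - x.2 * y.2, x.1 * y.2 + x.2 * y.1 - x.2 * y.2).
Definition eone : eis := (1, 0).

Lemma emulA : associative emul.
Proof. by move=> x y z; apply: eisP => /=; ring. Qed.
Lemma emulC : commutative emul.
Proof. by move=> x y; apply: eisP => /=; ring. Qed.
Lemma emul1 : left_id eone emul.
Proof. by move=> x; apply: eisP => /=; ring. Qed.
Lemma emulDl : left_distributive emul +%R.
Proof. by move=> x y z; apply: eisP => /=; ring. Qed.
Lemma eone_neq0 : eone != 0.
Proof. by []. Qed.

HB.instance Definition _ :=
  GRing.Zmodule_isComNzRing.Build eis emulA emulC emul1 emulDl eone_neq0.

(** The product of a + b w and its complex conjugate a + b w^2, which is [econj] after substituting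
    w^2 = - 1 - w. *)
Definition enorm x : int := x.1 ^+ 2 - x.1 * x.2 + x.2 ^+ 2.
Definition econj x : eis := (x.1 - x.2, - x.2).

Lemma enormM x y : enorm (x * y) = enorm x * enorm y.
Proof. by rewrite /enorm /=; ring. Qed.

Lemma enorm_ge0 x : 0 <= enorm x.
Proof. by rewrite /enorm; nia. Qed.

Lemma enorm_eq0 x : enorm x = 0 -> x = 0.
Proof.
rewrite /enorm => h; have x2 : x.2 = 0.
  apply/eqP; rewrite -sqrf_eq0 eq_le sqr_ge0 andbT.
  (* Four times the norm is (2a - b)^2 + 3b^2, so norm 0 forces b = 0. *)
  by have := sqr_ge0 (2 * x.1 - x.2); lia.
apply: eisP => //=; apply/eqP; rewrite -sqrf_eq0; apply/eqP.
by rewrite -[RHS]h x2; ring.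
Qed.

Lemma enorm_gt0 x : x != 0 -> 0 < enorm x.
Proof.
by move=> x0; rewrite lt_def enorm_ge0 andbT; apply: contra x0 => /eqP/enorm_eq0->.
Qed.

Definition eunit : pred eis := fun x => enorm x == 1.
(** At norm 1 the conjugate is the inverse; elsewhere the identity is the default value that unit
    rings require. *)
Definition einv x : eis := if eunit x then econj x else x.

Lemma eunit_mulVx : {in eunit, left_inverse 1 einv *%R}.
Proof.
move=> x; rewrite /in_mem /= /einv => ux; rewrite ux; move/eqP: ux.
by rewrite /enorm => h; apply: eisP => /=; [rewrite -[RHS]h|]; ring.
Qed.

Lemma eunit_intro x y : y * x = 1 -> eunit x.
Proof.
move=> /(congr1 enorm); rewrite enormM [RHS]/enorm /= => h.
rewrite /eunit; move: (enorm_ge0 x) (enorm_ge0 y) h.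
case: (enorm x) => // m; case: (enorm y) => // n _ _ /eqP.
by rewrite -PoszM eqz_nat muln_eq1 => /andP[].
Qed.

Lemma einv_out : {in [predC eunit], einv =1 id}.
Proof. by move=> x; rewrite /in_mem /= /einv => /negbTE ->. Qed.

HB.instance Definition _ :=
  GRing.ComNzRing_hasMulInverse.Build eis eunit_mulVx eunit_intro einv_out.

Lemma eis_integral : GRing.integral_domain_axiom eis.
Proof.
move=> x y /(congr1 enorm); rewrite enormM => /eqP; rewrite mulf_eq0.
by case/orP => /eqP/enorm_eq0 ->; rewrite eqxx ?orbT.
Qed.

HB.instance Definition _ := GRing.ComUnitRing_isIntegral.Build eis eis_integral.

Lemma unit_enorm x : (x \is a GRing.unit) = (enorm x == 1).
Proof. by []. Qed.

(** * Euclidean division, Bezout relations and coprimality *)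

Lemma int_round (s n : int) : 0 < n ->
  exists q : int, (- n <= 2 * (s - n * q) <= n).
Proof.
move=> n0; have h := divz_eq s n; have := ltz_pmod s n0.
have : 0 <= (s %% n)%Z by rewrite modz_ge0 // gt_eqF.
move: h; set q := (s %/ n)%Z; set r := (s %% n)%Z => h r0 rn.
have [le|gt] := leP (2 * r) n; first by exists q; lia.
by exists (q + 1); lia.
Qed.

(** The quotient rounds both coordinates of x * [econj y] / [enorm y] to nearest integers. *)
Lemma eis_euclid x y : y != 0 -> exists q, enorm (x - y * q) < enorm y.
Proof.
move=> /enorm_gt0 y0.
have [p hp] := int_round (x * econj y).1 y0.
have [q hq] := int_round (x * econj y).2 y0.
exists (p, q).
have: enorm ((x - y * (p, q)) * econj y) =
      enorm ((x * econj y).1 - enorm y * p, (x * econj y).2 - enorm y * q).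
  by rewrite /enorm /=; ring.
have e2 : enorm (econj y) = enorm y by rewrite /enorm /=; ring.
rewrite enormM e2 [in RHS]/enorm /=.
move: hp hq; set s := (_ - enorm y * p); set t := (_ - enorm y * q).
move=> /andP[s1 s2] /andP[t1 t2] h.
(* Write N for the norm of y. Since 4s^2 and 4t^2 are at most N^2 and - 2st <= s^2 + t^2, the norm
   s^2 - st + t^2 is at most 3N^2/4, below N^2. *)
have s3 : 0 <= (enorm y - 2 * s) * (enorm y + 2 * s) by apply: mulr_ge0; lia.
have t3 : 0 <= (enorm y - 2 * t) * (enorm y + 2 * t) by apply: mulr_ge0; lia.
have st : 0 <= (s + t) ^+ 2 by exact: sqr_ge0.
have y2 : 0 < enorm y * enorm y by exact: mulr_gt0.
rewrite ltNge; apply/negP => le.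
have : enorm y * enorm y <= s ^+ 2 - s * t + t ^+ 2 by rewrite -h ler_pM2r.
by lia.
Qed.

Definition dvde x y := exists z, y = x * z.
(** Coprimality in Bezout form, which can be combined and transferred by ring identities. *)
Definition coprime_eis x y := exists s t, s * x + t * y = 1.

Lemma eis_bezout x y :
  exists d s t x' y', [/\ d = s * x + t * y, x = d * x' & y = d * y'].
Proof.
have [n] := ubnP `|enorm y|%N; elim: n x y => // n IH x y yn.
have [->|y0] := eqVneq y 0.
  by exists x, 1, 0, 1, 0; split; ring.
have [q hq] := eis_euclid x y0.
have [|d [s [t [x' [y' [h1 h2 h3]]]]]] := IH y (x - y * q).
  by have := enorm_ge0 (x - y * q); lia.
exists d, t, (s - t * q), (y' + x' * q), x'; split=> //.
  by rewrite h1; ring.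
have -> : x = (x - y * q) + y * q by ring.
by rewrite h3 {1}h2; ring.
Qed.

Lemma coprime_eisC x y : coprime_eis x y -> coprime_eis y x.
Proof. by move=> [s [t h]]; exists t, s; rewrite addrC. Qed.

Lemma coprime_eisMr x y z :
  coprime_eis x y -> coprime_eis x z -> coprime_eis x (y * z).
Proof.
move=> [s [t h]] [s' [t' h']].
exists (s * (s' * x + t' * z) + t * y * s'), (t * t').
by rewrite -[RHS]mulr1 -{1}h -h'; ring.
Qed.

Lemma coprime_eisX3 x y : coprime_eis x y -> coprime_eis x (y ^+ 3).
Proof. by move=> h; rewrite !exprS expr0 mulr1; do 2!apply: coprime_eisMr => //. Qed.

Lemma coprime_eis_dvdl x x' y : dvde x' x -> coprime_eis x y -> coprime_eis x' y.
Proof. by move=> [z ->] [s [t h]]; exists (s * z), t; rewrite -h; ring. Qed.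

Lemma gauss_eis x y z : coprime_eis x y -> dvde x (y * z) -> dvde x z.
Proof.
move=> [s [t h]] [w hw]; exists (s * z + t * w).
by rewrite -[LHS]mul1r -h mulrDl -[t * y * z]mulrA hw; ring.
Qed.

Lemma dvde1_unit x : dvde x 1 -> x \is a GRing.unit.
Proof. by move=> [z h]; apply/unitrPr; exists z. Qed.

Lemma gcd_eis x y : exists d x' y', [/\ x = d * x', y = d * y' &
  d != 0 -> coprime_eis x' y'].
Proof.
have [d [s [t [x' [y' [h1 h2 h3]]]]]] := eis_bezout x y.
exists d, x', y'; split=> // d0; exists s, t; apply: (mulfI d0).
by rewrite mulr1 [RHS]h1 h2 h3; ring.
Qed.

(** * Divisibility of cubes and coprime factors of a cube *)

(** After division by the gcd, the cofactor of x divides a cube coprime to it, hence is a unit. *)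
Lemma dvde_cube x y : dvde (x ^+ 3) (y ^+ 3) -> dvde x y.
Proof.
have [->|x0] := eqVneq x 0.
  move=> [z]; rewrite expr0n mul0r => /eqP; rewrite expf_eq0 /= => /eqP->.
  by exists 0; rewrite mulr0.
have [d [x' [y' [hx hy cop]]]] := gcd_eis x y.
have d0 : d != 0 by apply: contra x0 => /eqP d0; rewrite hx d0 mul0r.
move=> [w]; rewrite hx hy !exprMn => hw.
have {hw}h : y' ^+ 3 = x' ^+ 3 * w.
  by apply: (mulfI (expf_neq0 3 d0)); rewrite hw; ring.
have /dvde1_unit ux : dvde x' 1.
  apply: (@gauss_eis _ (y' ^+ 3)); first exact: coprime_eisX3 (cop d0).
  by exists (x' ^+ 2 * w); rewrite h; ring.
by exists (x'^-1 * y'); rewrite -mulrA mulVKr.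
Qed.

(* With d = gcd(x, z) and d' = gcd(y, z), z divides d * d' since z divides
   x * y, while d ^+ 3 divides x and d' ^+ 3 divides y. *)
Lemma coprime_mul_cube x y z e : z != 0 -> e \is a GRing.unit ->
  coprime_eis x y -> x * y = e * z ^+ 3 ->
  exists f d, f \is a GRing.unit /\ x = f * d ^+ 3.
Proof.
move=> z0 ue cop h.
have [d [s [t [x' [z1 [d1 hx hz1]]]]]] := eis_bezout x z.
have [d' [s' [t' [y' [z2 [d2 hy hz2]]]]]] := eis_bezout y z.
have [w hw] : dvde (d ^+ 3) x.
  apply: (@gauss_eis _ y).
    apply: coprime_eisC; apply: coprime_eisX3; apply: coprime_eisC.
    by apply: coprime_eis_dvdl cop; exists x'.
  by exists (e * z1 ^+ 3); rewrite mulrC h hz1; ring.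
have [w' hw'] : dvde (d' ^+ 3) y.
  apply: (@gauss_eis _ x).
    apply: coprime_eisC; apply: coprime_eisX3.
    by apply: coprime_eisC; apply: coprime_eis_dvdl (coprime_eisC cop); exists y'.
  by exists (e * z2 ^+ 3); rewrite h hz2; ring.
have [k hk] : dvde z (d * d').
  exists (s * s' * e * z ^+ 2 + s * x * t' + t * y * s' + t * t' * z).
  have -> : d * d' = s * s' * (x * y) + z * (s * x * t' + t * y * s' + t * t' * z).
    by rewrite d1 d2; ring.
  by rewrite h; ring.
exists w, d; split; last by rewrite mulrC.
(* Cancelling z^3 in (z k)^3 w w' = e z^3 leaves k^3 w w' = e, which exhibits an inverse of w. *)
apply: dvde1_unit; exists (w' * k ^+ 3 * e^-1).
have z30 := expf_neq0 3 z0.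
apply: (mulfI z30); rewrite mulr1.
have : (z * k) ^+ 3 * (w * w') = e * z ^+ 3.
  by rewrite -hk -h hw hw'; ring.
move=> /(congr1 (fun a => e^-1 * a)); rewrite mulKr // => h2.
by rewrite -[LHS]h2; ring.
Qed.

(** * The prime [lam] and cubes modulo 3 and 9 *)

Definition omega : eis := (0, 1).
Definition lam : eis := (1, -1).

(** Modulo [lam], [omega] becomes 1 and 3 becomes 0, so the residue of x in the field of three
    elements is the sum of its coordinates. *)
Lemma dvd_lam x : dvde lam x <-> exists k, x.1 + x.2 = 3 * k.
Proof.
split=> [[z ->]|[k hk]]; first by exists z.2; rewrite /=; ring.
exists (x.1 - k, k); apply: eisP => /=; first by ring.
have -> : x.2 = 3 * k - x.1 by rewrite -hk; ring.
by ring.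
Qed.

Lemma cube_coord1 x : (x ^+ 3).1 = x.1 ^+ 3 + x.2 ^+ 3 - 3 * x.1 * x.2 ^+ 2.
Proof. by rewrite (_ : x ^+ 3 = x * (x * x)) //=; ring. Qed.

(** The factor 3 shows that cubes are rational integers modulo 3. *)
Lemma cube_coord2 x : (x ^+ 3).2 = 3 * (x.1 ^+ 2 * x.2 - x.1 * x.2 ^+ 2).
Proof. by rewrite (_ : x ^+ 3 = x * (x * x)) //=; ring. Qed.

Lemma int_cube_mod3 (n : int) : exists k, n ^+ 3 = n + 3 * k.
Proof.
pose q := (n %/ 3)%Z; have := divz_eq n 3.
have := ltz_pmod n (isT : 0 < 3 :> int); have := modz_ge0 n (isT : 3 != 0 :> int).
move: (n %% 3)%Z => r r0 r3 ->; rewrite -/q.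
have [->|[->|->]] : r = 0 \/ r = 1 \/ r = 2 by lia.
- by exists (9 * q ^+ 3 - q); ring.
- by exists (9 * q ^+ 3 + 9 * q ^+ 2 + 2 * q); ring.
- by exists (9 * q ^+ 3 + 18 * q ^+ 2 + 11 * q + 2); ring.
Qed.

(** Cubing fixes every residue modulo [lam], because the residue field has three elements. *)
Lemma cube_sum_mod3 x : exists k, (x ^+ 3).1 + (x ^+ 3).2 = x.1 + x.2 + 3 * k.
Proof.
have [k hk] := int_cube_mod3 (x.1 + x.2).
exists (k - 3 * x.1 * x.2 ^+ 2); rewrite cube_coord1 cube_coord2.
have -> : x.1 + x.2 + 3 * (k - 3 * x.1 * x.2 ^+ 2) =
  (x.1 + x.2 + 3 * k) - 9 * x.1 * x.2 ^+ 2 by ring.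
by rewrite -hk; ring.
Qed.

Lemma lam_cube x : dvde lam (x ^+ 3) -> dvde lam x.
Proof.
move=> /dvd_lam[k hk]; have [l hl] := cube_sum_mod3 x.
by apply/dvd_lam; exists (k - l); lia.
Qed.

Lemma int_euclid3 (m n k : int) : m * n = 3 * k ->
  (exists l, m = 3 * l) \/ (exists l, n = 3 * l).
Proof.
move=> h; have : (3 %| m * n)%Z by rewrite h dvdz_mulr.
rewrite dvdzE abszM Euclid_dvdM // -!(dvdzE 3).
by case/orP => /dvdzP[l ->]; [left|right]; exists l; rewrite mulrC.
Qed.

Lemma lam_prime x y : dvde lam (x * y) -> dvde lam x \/ dvde lam y.
Proof.
move=> /dvd_lam[k hk].
have : (x.1 + x.2) * (y.1 + y.2) = 3 * (k + x.2 * y.2).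
  by rewrite [RHS]mulrDr -hk /=; ring.
by case/int_euclid3 => h; [left|right]; apply/dvd_lam.
Qed.

Lemma lam_coprime x y : coprime_eis x y -> dvde lam x -> dvde lam y -> False.
Proof.
move=> [s [t h]] [a ha] [b hb].
have /dvd_lam[k /=] : dvde lam 1 by exists (s * a + t * b); rewrite -h ha hb; ring.
by lia.
Qed.

Lemma lam_unit_cube x e : e \is a GRing.unit -> dvde lam (e * x ^+ 3) -> dvde lam x.
Proof.
move=> ue [y hy]; apply: lam_cube; exists (e^-1 * y).
by rewrite mulrCA -hy mulKr.
Qed.

(** Up to sign x is 1 + [lam] t. As [lam]^2 = - 3 [omega], its cube is 1 + 3 [lam] (t - [omega] t^3)
    - 9 [omega] t^2, and [lam] divides the bracket since t^3 and t agree modulo [lam]. *)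
Lemma cube_mod9 x : ~ dvde lam x ->
  exists w, x ^+ 3 = 1 + 9 * w \/ x ^+ 3 = - 1 + 9 * w.
Proof.
move=> nx.
have key t : exists w, (1 + lam * t) ^+ 3 = 1 + 9 * w.
  have [k hk] := cube_sum_mod3 t.
  have /dvd_lam[w hw] : exists l,
      (t - omega * t ^+ 3).1 + (t - omega * t ^+ 3).2 = 3 * l.
    move: hk; rewrite cube_coord2 => hk.
    exists (- k + 3 * (t.1 ^+ 2 * t.2 - t.1 * t.2 ^+ 2)).
    have -> : (t - omega * t ^+ 3).1 + (t - omega * t ^+ 3).2 =
        t.1 + t.2 + 2 * (t ^+ 3).2 - (t ^+ 3).1.
      by move: (t ^+ 3) => u; rewrite /=; ring.
    rewrite cube_coord2; lia.
  exists (- omega * w - omega * t ^+ 2).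
  have l2 : lam ^+ 2 = - 3 * omega by apply: eisP.
  have -> : (1 + lam * t) ^+ 3 =
      1 + 3 * lam * t + 3 * lam ^+ 2 * t ^+ 2 + lam * lam ^+ 2 * t ^+ 3 by ring.
  have -> : 1 + 9 * (- omega * w - omega * t ^+ 2) =
      1 + 3 * ((- 3 * omega) * w) + 3 * (- 3 * omega) * t ^+ 2 by ring.
  rewrite -l2 {3}expr2 -[lam * lam * w]mulrA -hw l2; ring.
have [k hk] : exists k, x.1 + x.2 = 3 * k + 1 \/ x.1 + x.2 = 3 * k - 1.
  have nx3 k : x.1 + x.2 <> 3 * k by move=> h; apply: nx; apply/dvd_lam; exists k.
  have := nx3 ((x.1 + x.2) %/ 3)%Z.
  case: (int_round (x.1 + x.2) (isT : 0 < 3 :> int)) => q hq _.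
  by exists q; have := nx3 q; lia.
case: hk => hk.
  have /dvd_lam[t ht] : exists l, (x - 1).1 + (x - 1).2 = 3 * l
    by exists k; rewrite /=; lia.
  have [w hw] := key t; exists w; left.
  by rewrite -hw -ht; ring.
have /dvd_lam[t ht] : exists l, (- x - 1).1 + (- x - 1).2 = 3 * l
  by exists (- k); rewrite /=; lia.
have [w hw] := key t; exists (- w); right.
have -> : -1 + 9 * - w = - (1 + 9 * w) by ring.
by rewrite -hw -ht; ring.
Qed.

(* Cubes are rational integers modulo 3, so e x^3 can only be one if either
   x^3 vanishes modulo 3 or e is rational. *)
Lemma unit_mul_cube_coord2 e x k : e \is a GRing.unit -> (e * x ^+ 3).2 = 3 * k ->
  dvde lam x \/ (e = 1 \/ e = -1).
Proof.
rewrite unit_enorm /enorm => /eqP ue hk; have [l hl] := cube_sum_mod3 x.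
have : e.2 * (x.1 + x.2) =
    3 * (k - e.2 * l - (e.1 - 2 * e.2) * (x.1 ^+ 2 * x.2 - x.1 * x.2 ^+ 2)).
  have -> : x.1 + x.2 = (x ^+ 3).1 + (x ^+ 3).2 - 3 * l by rewrite hl; ring.
  have -> : 3 * (k - e.2 * l - (e.1 - 2 * e.2) * (x.1 ^+ 2 * x.2 - x.1 * x.2 ^+ 2)) =
    3 * k - 3 * e.2 * l - (e.1 - 2 * e.2) * (x ^+ 3).2 by rewrite cube_coord2; ring.
  by rewrite -hk; move: (x ^+ 3) => u; rewrite /=; ring.
case/int_euclid3 => -[m hm]; last by left; apply/dvd_lam; exists m.
right; have m0 : m = 0.
  (* With second coordinate 3m, norm 1 gives 4 = (2 [e.1] - 3m)^2 + 27m^2, so m = 0. *)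
  apply/eqP; rewrite -sqrf_eq0 eq_le sqr_ge0 andbT.
  by have := sqr_ge0 (2 * e.1 - e.2); rewrite hm in ue *; lia.
rewrite m0 mulr0 in hm; rewrite hm in ue.
have /eqP : (e.1 - 1) * (e.1 + 1) = 0 by lia.
rewrite mulf_eq0 => /orP[] /eqP h; [left|right]; apply: eisP => /=; lia.
Qed.

(** * Fermat's descent *)

Lemma coprime_eis_comb a b c d x y :
  coprime_eis (a * x + b * y) (c * x + d * y) -> coprime_eis x y.
Proof.
by move=> [s [t h]]; exists (s * a + t * c), (s * b + t * d); rewrite -h; ring.
Qed.

Lemma coprime_eisNr x y : coprime_eis x y -> coprime_eis x (- y).
Proof. by move=> [s [t h]]; exists s, (- t); rewrite -h; ring. Qed.

Lemma omega2 : omega ^+ 2 = - 1 - omega.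
Proof. exact: eisP. Qed.

Lemma lamE : lam = 1 - omega.
Proof. exact: eisP. Qed.

(* b * B ^+ 3 + c * C ^+ 3 vanishes modulo 3, which forces c / b = 1 or -1. *)
Lemma three_cubes_normalize a b c A B C :
  a \is a GRing.unit -> b \is a GRing.unit -> c \is a GRing.unit ->
  a * A ^+ 3 + b * B ^+ 3 + c * C ^+ 3 = 0 ->
  coprime_eis B C -> dvde lam A ->
  exists e D, [/\ e \is a GRing.unit, coprime_eis B D & B ^+ 3 + D ^+ 3 = e * A ^+ 3].
Proof.
move=> ua ub uc h cop [A' hA].
have uc' : c / b \is a GRing.unit by rewrite unitrM uc unitrV.
have ua' : - (a / b) \is a GRing.unit by rewrite unitrN unitrM ua unitrV.
have h' : B ^+ 3 + (c / b) * C ^+ 3 = - (a / b) * A ^+ 3.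
  apply: (mulrI ub); apply/eqP; rewrite -subr_eq0 -[X in _ == X]h; apply/eqP.
  have -> : b * (B ^+ 3 + c / b * C ^+ 3) - b * (- (a / b) * A ^+ 3)
     = b / b * (a * A ^+ 3 + c * C ^+ 3) + b * B ^+ 3 by ring.
  by rewrite divrr //; ring.
have nC : ~ dvde lam C.
  move=> lC; apply: (lam_coprime cop _ lC); apply: lam_cube.
  case: lC => C' hC.
  exists (- (a / b) * lam ^+ 2 * A' ^+ 3 - c / b * lam ^+ 2 * C' ^+ 3).
  have -> : B ^+ 3 = - (a / b) * A ^+ 3 - c / b * C ^+ 3 by rewrite -h'; ring.
  by rewrite hA hC; ring.
(* Since 3 divides [lam]^3, the term in A^3 vanishes modulo 3; so does the second coordinate of
   B^3. *)
have l3 : lam ^+ 3 = 3 * (- omega * lam) by apply: eisP.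
have [k hk] : exists k, (c / b * C ^+ 3).2 = 3 * k.
  exists ((- (a / b) * (- omega * lam) * A' ^+ 3).2 - (B.1 ^+ 2 * B.2 - B.1 * B.2 ^+ 2)).
  have -> : c / b * C ^+ 3 = - (a / b) * A ^+ 3 - B ^+ 3 by rewrite -h'; ring.
  rewrite mulrBr -cube_coord2 hA exprMn l3.
  have -> : - (a / b) * (3 * (- omega * lam) * A' ^+ 3) =
      3 * (- (a / b) * (- omega * lam) * A' ^+ 3) by ring.
  by move: (- (a / b) * (- omega * lam) * A' ^+ 3) (B ^+ 3) => u w /=; ring.
have [//|[e1|e1]] := unit_mul_cube_coord2 uc' hk; rewrite e1 in h'.
  by exists (- (a / b)), C; split=> //; rewrite -h'; ring.
exists (- (a / b)), (- C); split=> //; first exact: coprime_eisNr.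
by rewrite -h'; ring.
Qed.

Lemma enorm_unit_cube e x : e \is a GRing.unit -> enorm (e * x ^+ 3) = enorm x ^+ 3.
Proof.
by rewrite unit_enorm enormM => /eqP->; rewrite mul1r !exprS !expr0 !mulr1 !enormM.
Qed.

(** By coprimality [lam] divides neither x nor y, so the sum of their cubes is 0, 2 or -2 modulo 9.
    As [lam] does not divide 2, the sum is a multiple of 9, an associate of [lam]^4; one factor
    [lam] is left for z^3. *)
Lemma lam_dvd_cubes x y z e : coprime_eis x y -> e \is a GRing.unit ->
  x ^+ 3 + y ^+ 3 = e * (lam * z) ^+ 3 -> dvde lam z.
Proof.
move=> cop ue h.
have lxy u w : u ^+ 3 + w ^+ 3 = e * (lam * z) ^+ 3 -> dvde lam u -> dvde lam w.
  move=> h' [u' hu]; apply: lam_cube.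
  exists (e * lam ^+ 2 * z ^+ 3 - lam ^+ 2 * u' ^+ 3).
  have -> : w ^+ 3 = e * (lam * z) ^+ 3 - u ^+ 3 by rewrite -h'; ring.
  by rewrite hu; ring.
have nx : ~ dvde lam x by move=> lx; apply: (lam_coprime cop) (lx) (lxy _ _ h lx).
have ny : ~ dvde lam y.
  move=> ly; apply: (lam_coprime cop) (lxy _ _ _ ly) (ly).
  by rewrite addrC.
have l3 : lam ^+ 3 = lam * (- 3 * omega) by apply: eisP.
have nl w u : (w = 2 \/ w = - 2) -> w + 9 * u <> e * (lam * z) ^+ 3.
  move=> hw hu; have /dvd_lam[k] : dvde lam w.
    exists (e * (- 3 * omega) * z ^+ 3 - 3 * (1 - omega ^+ 2) * u).
    have -> : w = e * (lam * z) ^+ 3 - 9 * u by rewrite -hu; ring.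
    have n9 : 9 = lam * (3 * (1 - omega ^+ 2)) by apply: eisP.
    by rewrite n9 exprMn l3; ring.
  by case: hw => -> /=; lia.
have n9 : 9 = lam ^+ 3 * (lam * omega) by apply: eisP.
have fin u : 9 * u = e * (lam * z) ^+ 3 -> dvde lam z.
  move=> hu; apply: (lam_unit_cube ue); exists (omega * u).
  have l30 : lam ^+ 3 != 0 by rewrite expf_neq0.
  apply: (mulfI l30).
  have -> : lam ^+ 3 * (e * z ^+ 3) = e * (lam * z) ^+ 3 by ring.
  by rewrite -hu n9; ring.
have [w [hx|hx]] := cube_mod9 nx; have [w' [hy|hy]] := cube_mod9 ny;
  rewrite hx hy in h.
- by case: (@nl 2 (w + w')); [left | rewrite -h; ring].
- by apply: (fin (w + w')); rewrite -h; ring.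
- by apply: (fin (w + w')); rewrite -h; ring.
- by case: (@nl (- 2) (w + w')); [right | rewrite -h; ring].
Qed.

(** The factors x + y, x + [omega] y and x + [omega]^2 y agree modulo [lam], and [lam] divides their
    product, hence each of them. *)
Lemma sum_cubes_factor x y z e : coprime_eis x y -> e \is a GRing.unit ->
  x ^+ 3 + y ^+ 3 = e * (lam * z) ^+ 3 ->
  exists p q r, [/\ p * q * r = e * z ^+ 3, p + omega * q + omega ^+ 2 * r = 0,
    coprime_eis p q, coprime_eis p r & coprime_eis q r].
Proof.
move=> cop ue h.
have /dvd_lam[k hk] : dvde lam (x ^+ 3 + y ^+ 3).
  by exists (e * lam ^+ 2 * z ^+ 3); rewrite h; ring.
have [kx hx] := cube_sum_mod3 x; have [ky hy] := cube_sum_mod3 y.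
have [p hp] : dvde lam (x + y).
  apply/dvd_lam; exists (k - kx - ky).
  move: hk hx hy; move: (x ^+ 3) (y ^+ 3) => u w; rewrite /=; lia.
have ho := omega2.
have l30 : lam ^+ 3 != 0 by rewrite expf_neq0.
have ex : x = lam * p - y by rewrite -hp; ring.
(* As [lam] p = x + y, these are the three linear factors divided by [lam]. *)
exists p, (p - y), (p + omega ^+ 2 * y).
split.
- apply: (mulfI l30).
  have -> : lam ^+ 3 * (e * z ^+ 3) = e * (lam * z) ^+ 3 by ring.
  rewrite -h ex lamE; ring: ho.
- ring: ho.
(* For each pair of factors, the coefficients express x and y through that pair, so coprimality of x
   and y passes to it. *)
- apply: (@coprime_eis_comb (- omega) 1 1 (- 1)).
  by congr coprime_eis: cop; rewrite ?ex ?lamE; ring: ho.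
- apply: (@coprime_eis_comb (lam + omega) (- omega) (- omega) omega).
  by congr coprime_eis: cop; rewrite ?ex ?lamE; ring: ho.
- apply: (@coprime_eis_comb (- omega) 1 (omega ^+ 2) (- omega ^+ 2)).
  by congr coprime_eis: cop; rewrite ?ex ?lamE; ring: ho.
Qed.

Lemma sum_cubes_descent x y z e : z != 0 -> e \is a GRing.unit -> coprime_eis x y ->
  dvde lam z -> x ^+ 3 + y ^+ 3 = e * z ^+ 3 -> False.
Proof.
have [n] := ubnP `|enorm z|%N; elim: n x y z e => // n IH x y z e zn z0 ue cop.
move=> [z' hz] h; rewrite hz in h.
have z'0 : z' != 0 by apply: contra z0 => /eqP z'0; rewrite hz z'0 mulr0.
(* The norm of [lam] is 3, so the norm of [z'] is strictly smaller than that of z. *)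
have Nz : enorm z = 3 * enorm z' by rewrite hz enormM.
have Nz'0 := enorm_gt0 z'0.
have lz' := lam_dvd_cubes cop ue h.
have [p [q [r [hpqr hsum cpq cpr cqr]]]] := sum_cubes_factor cop ue h.
have cqp := coprime_eisC cpq; have crp := coprime_eisC cpr.
have crq := coprime_eisC cqr.
have [a [A [ua hA]]] : exists f d, f \is a GRing.unit /\ p = f * d ^+ 3.
  apply: (@coprime_mul_cube p (q * r) z' e) => //; first exact: coprime_eisMr.
  by rewrite -hpqr; ring.
have [b [B [ub hB]]] : exists f d, f \is a GRing.unit /\ q = f * d ^+ 3.
  apply: (@coprime_mul_cube q (p * r) z' e) => //; first exact: coprime_eisMr.
  by rewrite -hpqr; ring.
have [c [C [uc hC]]] : exists f d, f \is a GRing.unit /\ r = f * d ^+ 3.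
  apply: (@coprime_mul_cube r (p * q) z' e) => //; first exact: coprime_eisMr.
  by rewrite -hpqr; ring.
have Nprod : (enorm A * enorm B * enorm C) ^+ 3 = enorm z' ^+ 3.
  move/(congr1 enorm): hpqr; rewrite enorm_unit_cube // => <-.
  rewrite (enormM (p * q)) (enormM p) hA hB hC !enorm_unit_cube //.
  by rewrite !exprMn.
have {}Nprod : enorm A * enorm B * enorm C = enorm z'.
  apply: (@pexpIrn _ 3) => //; rewrite nnegrE ?enorm_ge0 //.
  by rewrite !mulr_ge0 ?enorm_ge0.
have /andP[/andP[A0 B0] C0] : (A != 0) && (B != 0) && (C != 0).
  rewrite -!negb_or; apply: contraTN Nz'0 => h0; rewrite -Nprod.
  by case/orP: h0 => [/orP[]|] /eqP->; rewrite ?(mulr0, mul0r) ltxx.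
have NA := enorm_gt0 A0; have NB := enorm_gt0 B0; have NC := enorm_gt0 C0.
have NBC : 0 < enorm A * enorm B by rewrite mulr_gt0.
(* The norms of A, B, C are positive integers with product [enorm z'], so none exceeds it. *)
have [lA lB lC] : [/\ enorm A <= enorm z', enorm B <= enorm z' & enorm C <= enorm z'].
  have NAC : 0 < enorm A * enorm C by rewrite mulr_gt0.
  by rewrite -Nprod; split; [rewrite -mulrA ler_peMr ?enorm_ge0|
    rewrite [_ * enorm B]mulrC -mulrA ler_peMr ?enorm_ge0|
    rewrite ler_peMl ?enorm_ge0]; rewrite // -gtz0_ge1 ?mulr_gt0.
have dA : dvde A p by rewrite hA; exists (a * A ^+ 2); ring.
have dB : dvde B q by rewrite hB; exists (b * B ^+ 2); ring.
have dC : dvde C r by rewrite hC; exists (c * C ^+ 2); ring.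
have cop' u w f g : coprime_eis u w -> dvde f u -> dvde g w -> coprime_eis f g.
  move=> cuw df dg; apply: coprime_eis_dvdl df _; apply: coprime_eisC.
  by apply: coprime_eis_dvdl dg _; apply: coprime_eisC.
(* The factor divisible by [lam] goes first; its cube root [A'] becomes the new z of a smaller
   solution. *)
have step a' b' c' A' B' C' : a' \is a GRing.unit -> b' \is a GRing.unit ->
    c' \is a GRing.unit -> a' * A' ^+ 3 + b' * B' ^+ 3 + c' * C' ^+ 3 = 0 ->
    coprime_eis B' C' -> dvde lam A' -> A' != 0 -> enorm A' <= enorm z' -> False.
  move=> ua' ub' uc' h3 cBC lA' A'0 NA'.
  have [e' [D [ue' cBD hD]]] := three_cubes_normalize ua' ub' uc' h3 cBC lA'.
  by apply: (IH B' D A' e') => //; have := enorm_gt0 A'0; lia.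
have ub' : omega * b \is a GRing.unit by rewrite unitrM ub.
have uc' : omega ^+ 2 * c \is a GRing.unit by rewrite unitrM uc.
have [w hw] := lz'.
have : dvde lam (p * q * r) by rewrite hpqr hw; exists (e * lam ^+ 2 * w ^+ 3); ring.
rewrite hA hB hC in hsum *.
(* Each of the three factors in turn may be the one divisible by [lam]. *)
case/lam_prime => [/lam_prime[l|l]|l].
- have {}l := lam_unit_cube ua l.
  apply: (step a (omega * b) (omega ^+ 2 * c) A B C) => //.
    by rewrite -hsum; ring.
  exact: cop' cqr dB dC.
- have {}l := lam_unit_cube ub l.
  apply: (step (omega * b) a (omega ^+ 2 * c) B A C) => //.
    by rewrite -hsum; ring.
  exact: cop' cpr dA dC.
- have {}l := lam_unit_cube uc l.
  apply: (step (omega ^+ 2 * c) a (omega * b) C A B) => //.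
    by rewrite -hsum; ring.
  exact: cop' cpq dA dB.
Qed.

(** * Reduction to coprime Eisenstein integers *)

(** The cube of the gcd d of x and y divides z^3, so d divides z and can be cancelled before the
    descent. *)
Lemma unit_cube_not_sum_cubes x y z e : z != 0 -> e \is a GRing.unit ->
  e != 1 -> e != -1 -> x ^+ 3 + y ^+ 3 <> e * z ^+ 3.
Proof.
move=> z0 ue e1 eN1 h.
have [d [x' [y' [hx hy cop]]]] := gcd_eis x y.
have z30 := expf_neq0 3 z0.
have d0 : d != 0.
  apply: contra z30 => /eqP d0; rewrite -(mulrI_eq0 _ (mulrI ue)) -h hx hy d0.
  by rewrite !mul0r !expr0n addr0.
have {}cop := cop d0.
have [z' hz] : dvde d z.
  apply: dvde_cube; exists (e^-1 * (x' ^+ 3 + y' ^+ 3)).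
  apply: (mulrI ue); rewrite -h hx hy.
  have -> : e * (d ^+ 3 * (e^-1 * (x' ^+ 3 + y' ^+ 3))) =
      e / e * (d ^+ 3 * (x' ^+ 3 + y' ^+ 3)) by ring.
  by rewrite divrr //; ring.
have h' : x' ^+ 3 + y' ^+ 3 = e * z' ^+ 3.
  apply: (mulfI (expf_neq0 3 d0)).
  have -> : d ^+ 3 * (e * z' ^+ 3) = e * z ^+ 3 by rewrite hz; ring.
  by rewrite -h hx hy; ring.
have z'0 : z' != 0 by apply: contra z0 => /eqP z'0; rewrite hz z'0 mulr0.
have lz' : dvde lam z'.
  (* A sum of two cubes is rational modulo 3, and e is neither 1 nor -1, so [lam] must divide
     [z']. *)
  have h2 : (e * z' ^+ 3).2 = 3 * ((x'.1 ^+ 2 * x'.2 - x'.1 * x'.2 ^+ 2) +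
      (y'.1 ^+ 2 * y'.2 - y'.1 * y'.2 ^+ 2)).
    by rewrite -h' [RHS]mulrDr -!cube_coord2.
  have [//|[he|he]] := unit_mul_cube_coord2 ue h2.
    by rewrite he eqxx in e1.
  by rewrite he eqxx in eN1.
exact: sum_cubes_descent z'0 ue cop lz' h'.
Qed.

(** * Transfer to the field containing u and v *)

Definition eis_val (F : numFieldType) (u : F) x : F := x.1%:~R + x.2%:~R * u.

Section Embedding.
Variables (F : numFieldType) (u v : F).
Hypotheses (hu : u ^+ 2 + u + 1 = 0) (hv : v ^+ 2 + v + 1 = 0) (huv : u <> v).

Let u2 : u ^+ 2 = - 1 - u.
Proof. by apply/eqP; rewrite -subr_eq0 -[X in _ == X]hu; apply/eqP; ring. Qed.

Lemma other_root : v = - 1 - u.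
Proof.
have /eqP : (u - v) * (v - (- 1 - u)) = 0.
  have -> : (u - v) * (v - (- 1 - u)) = (u ^+ 2 + u + 1) - (v ^+ 2 + v + 1) by ring.
  by rewrite hu hv subrr.
by rewrite mulf_eq0 !subr_eq0 => /orP[]/eqP.
Qed.

Lemma eis_valD x y : eis_val u (x + y) = eis_val u x + eis_val u y.
Proof. by rewrite /eis_val /= !rmorphD /=; ring. Qed.

Lemma eis_valN x : eis_val u (- x) = - eis_val u x.
Proof. by rewrite /eis_val /= !rmorphN /=; ring. Qed.

Lemma eis_valM x y : eis_val u (x * y) = eis_val u x * eis_val u y.
Proof.
rewrite /eis_val /= !rmorphB !rmorphD !rmorphM /=.
by ring: u2.
Qed.

Lemma eis_valX3 x : eis_val u (x ^+ 3) = eis_val u x ^+ 3.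
Proof. by rewrite !exprS !expr0 !mulr1 !eis_valM. Qed.

Lemma eis_val1 : eis_val u 1 = 1.
Proof. by rewrite /eis_val /= mul0r addr0. Qed.

Lemma eis_val_int (n : int) : eis_val u (n, 0) = n%:~R.
Proof. by rewrite /eis_val /= mul0r addr0. Qed.

(** Multiplying by the image of the conjugate gives the norm, an integer that must vanish in
    characteristic 0. *)
Lemma eis_val_eq0 x : eis_val u x = 0 -> x = 0.
Proof.
move=> h; apply: enorm_eq0; apply/eqP; rewrite -(intr_eq0 F); apply/eqP.
rewrite -(mul0r (eis_val u (econj x))) -h /eis_val /enorm /=.
rewrite rmorphN !(rmorphD, rmorphB, rmorphM, rmorphXn) /=.
by ring: u2.
Qed.

Lemma eis_val_inj : injective (eis_val u).
Proof.
move=> x y h; apply/eqP; rewrite -subr_eq0; apply/eqP; apply: eis_val_eq0.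
by rewrite eis_valD eis_valN h subrr.
Qed.

Lemma in_O_eis (z : F) : in_O u v z -> exists x, z = eis_val u x.
Proof.
move=> [a [b [c ->]]]; exists (a - c, b - c).
by rewrite other_root /eis_val /= !rmorphB /=; ring.
Qed.

(** The product of the three denominators clears them all, and v = - 1 - u removes v. *)
Lemma in_K_eis (z : F) : in_K u v z ->
  exists x (n : int), n != 0 /\ z * n%:~R = eis_val u x.
Proof.
move=> [a [b [c ->]]].
exists (numq a * denq b * denq c - numq c * denq a * denq b,
        numq b * denq a * denq c - numq c * denq a * denq b).
exists (denq a * denq b * denq c); split; first by rewrite !mulf_neq0 ?denq_neq0.
have d0 (r : rat) : (denq r)%:~R != 0 :> F by rewrite intr_eq0 denq_neq0.
rewrite other_root /eis_val /= !rmorphB !rmorphM /= /ratr.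
by field; rewrite !d0.
Qed.

Lemma unit_O_eis (z : F) : unit_O u v z ->
  exists2 x, x \is a GRing.unit & z = eis_val u x.
Proof.
move=> [/in_O_eis[x ->] [w /in_O_eis[y ->]]].
rewrite -eis_valM -eis_val1 => /eis_val_inj xy.
by exists x => //; apply/unitrPr; exists y.
Qed.

Lemma unit_O_not_sum_cubes (e x y : F) : unit_O u v e -> e <> 1 -> e <> -1 ->
  in_K u v x -> in_K u v y -> e <> x ^+ 3 + y ^+ 3.
Proof.
move=> /unit_O_eis[f uf ->] f1 fN1 /in_K_eis[p [m [m0 hp]]] /in_K_eis[q [n [n0 hq]]] h.
have mn0 : (m * n, 0) != 0 :> eis.
  by apply/eqP => /(congr1 fst) /= /eqP; rewrite mulf_eq0 (negbTE m0) (negbTE n0).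
(* Multiplying e = x^3 + y^3 by (m n)^3, where x m and y n are the images of p and q, gives an
   equation between Eisenstein integers. *)
apply: (@unit_cube_not_sum_cubes (p * (n, 0)) (q * (m, 0)) (m * n, 0) f) => //.
- by apply/eqP => e1; apply: f1; rewrite e1 eis_val1.
- by apply/eqP => e1; apply: fN1; rewrite e1 eis_valN eis_val1.
apply: eis_val_inj.
rewrite eis_valD eis_valM !eis_valX3 !eis_valM !eis_val_int -hp -hq h.
by rewrite rmorphM /=; ring.
Qed.

End Embedding.

Theorem theorem1p6 (R : realType) (u v : R[i])
    (hu : u ^+ 2 + u + 1 = 0) (hv : v ^+ 2 + v + 1 = 0) (huv : u <> v)
    (e : R[i]) (he : unit_O u v e) (he1 : e <> 1) (heN1 : e <> -1) :
  ~ (exists x y : R[i], in_K u v x /\ in_K u v y /\ e = x ^+ 3 + y ^+ 3).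
Proof.
move=> [x [y [xK [yK h]]]].
exact: (unit_O_not_sum_cubes hu hv huv he he1 heN1 xK yK h).
Qed.
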